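(* Let $f$ be an invitation-promoted monotone (IP-MON) allocation rule and let $\theta$ be the type profile. For each bidder $i$ let $\tilde p_i=v_i^\ast(r_i)$, $\bar p_i=0$, and let $p^\ast=\{f_i(\theta)\tilde p_i+(1-f_i(\theta))\bar p_i\}_{i\in N}$. Then $\mathcal M^\ast=(f,p^\ast)$ is individually rational and strategyproof, and for any other individually rational and strategyproof mechanism $\mathcal M'=(f,p')$ with the same allocation rule, $\mathrm{Rev}^{\mathcal M^\ast}(\theta)\ge \mathrm{Rev}^{\mathcal M'}(\theta)$.
   Context: Network auction model. There is a finite set $N$ of bidders and a seller. Bidder $i$ has true type $\theta_i=(v_i,r_i)$, where $v_i\in\mathbb R_{\ge0}$ (arbitrary) is her value for winning and $r_i$ is her set of neighbors in the social network; $\theta=(\theta_i)_{i\in N}$. She reports $\theta_i'=(v_i',r_i')\in\Theta_i=\mathbb R_{\ge 0}\times\mathcal P(r_i)$; $\Theta=\times_i\Theta_i$. A mechanism is $\mathcal M=(f,p)$ with $f_i:\Theta\to\{0,1\}$ and $p_i:\Theta\to\mathbb R$; utility is $u_i(\theta')=f_i(\theta')v_i-p_i(\theta')$; revenue is $\mathrm{Rev}^{\mathcal M}(\theta')=\sum_{i\in N}p_i(\theta')$. Individually rational: $u_i((v_i,r_i'),\theta'_{-i})\ge0$ for all $i$, all true values $v_i$, all $r_i'\subseteq r_i$, all $\theta'_{-i}$. Strategyproof: $u_i((v_i,r_i),\theta'_{-i})\ge u_i((v_i',r_i'),\theta'_{-i})$ for all $i$, all true types $(v_i,r_i)$, all $(v_i',r_i')\in\Theta_i$,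 all $\theta'_{-i}$. Invitation-promoted order: $(v_i^1,r_i^1)\succeq_{\mathcal P}(v_i^2,r_i^2)$ if $v_i^1\ge v_i^2$ and $r_i^2\subseteq r_i^1$. $f$ is IP-MON if for every $i$ and $\theta_{-i}$, $f_i(\theta_i,\theta_{-i})=1$ implies $f_i(\theta_i',\theta_{-i})=1$ for all $\theta_i'\succeq_{\mathcal P}\theta_i$. Given the others' reports, the critical winning bid of $i$ under invitation action $r_i'$ is $v_i^\ast(r_i')=\inf\{x\in\mathbb R_{\ge0}: f_i((x,r_i'),\theta_{-i})=1\}$ (it is only used in the payment when $f_i=1$, in which case it is finite). At a general report profile $\theta'$ the payment $p_i^\ast(\theta')$ is given by the same formula with the critical bid computed from $\theta'_{-i}$ and with the reported set $r_i'$ in place of $r_i$. *)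

(* Defs.v *)
From mathcomp Require Import all_boot all_order all_algebra.
From mathcomp Require Import boolp classical_sets reals.

Set Implicit Arguments.
Unset Strict Implicit.
Unset Printing Implicit Defensive.

Import Order.TTheory GRing.Theory Num.Theory.
Local Open Scope ring_scope.

(* The vertices of the social network are the bidders [Some i] and the seller
   [None].  The edge relation [e] is arbitrary (neither symmetry nor
   irreflexivity is needed), so directed and undirected networks are covered. *)
Definition neighbors (N : finType) (e : rel (option N)) (i : N) :
    {set option N} :=
  [set x | e (Some i) x].

(* Theta_i: the reports available to bidder [i] in the network [e].  Bidder [i]
   cannot report anyone who is not among her true neighbors. *)
Record report (R : realType) (N : finType) (e : rel (option N)) (i : N) :=
  Report {
    bid : R;
    bid_ge0 : 0 <= bid;
    invited : {set option N};
    invited_sub : invited \subset neighbors e i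
  }.

Definition profile (R : realType) (N : finType) (e : rel (option N)) : Type :=
  forall i : N, report R e i.

Definition true_type (R : realType) (N : finType) (e : rel (option N)) (i : N)
    (v : R) (hv : 0 <= v) : report R e i :=
  Report hv (subxx (neighbors e i)).

Definition allocation (R : realType) (N : finType) (e : rel (option N)) : Type :=
  N -> profile R e -> bool.

Definition payment (R : realType) (N : finType) (e : rel (option N)) : Type :=
  N -> profile R e -> R.

Record mechanism (R : realType) (N : finType) (e : rel (option N)) :=
  Mechanism { alloc : allocation R e; pay : payment R e }.

(* [v] is the true value of bidder [i]; it need not be her bid in [th]. *)
Definition utility (R : realType) (N : finType) (e : rel (option N))
    (M : mechanism R e) (i : N) (v : R) (th : profile R e) : R :=
  (alloc M i th)%:R * v - pay M i th.

Definition revenue (R : realType) (N : finType) (e : rel (option N))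
    (M : mechanism R e) (th : profile R e) : R :=
  \sum_(i : N) pay M i th.

(* [dfwith th t] is the profile (t, th_{-i}) when [t : report R e i]. *)

Definition individually_rational (R : realType) (N : finType)
    (e : rel (option N)) (M : mechanism R e) : Prop :=
  forall (i : N) (v : R) (hv : 0 <= v)
         (s : {set option N}) (hs : s \subset neighbors e i) (th : profile R e),
    0 <= utility M i v (dfwith th (Report hv hs)).

Definition strategyproof (R : realType) (N : finType) (e : rel (option N))
    (M : mechanism R e) : Prop :=
  forall (i : N) (v : R) (hv : 0 <= v) (t : report R e i) (th : profile R e),
    utility M i v (dfwith th t) <=
    utility M i v (dfwith th (true_type e i hv)).

(* [ip_ge t1 t2] is t1 >=_P t2, the invitation-promoted order. *)
Definition ip_ge (R : realType) (N : finType) (e : rel (option N)) (i : N)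
    (t1 t2 : report R e i) : Prop :=
  bid t2 <= bid t1 /\ invited t2 \subset invited t1.

Definition ip_monotone (R : realType) (N : finType) (e : rel (option N))
    (f : allocation R e) : Prop :=
  forall (i : N) (th : profile R e) (t t' : report R e i),
    f i (dfwith th t) -> ip_ge t' t -> f i (dfwith th t').

(* v_i^*(s) given th_{-i}; the component of [th] at [i] is irrelevant.  When no
   bid wins, [inf set0 = 0]; this value is multiplied by 0 in [critical_pay]. *)
Definition critical_bid (R : realType) (N : finType) (e : rel (option N))
    (f : allocation R e) (i : N) (th : profile R e)
    (s : {set option N}) (hs : s \subset neighbors e i) : R :=
  inf [set x : R | exists hx : 0 <= x, f i (dfwith th (Report hx hs))]%classic.

Definition critical_pay (R : realType) (N : finType) (e : rel (option N))
    (f : allocation R e) : payment R e :=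
  fun i th =>
    let win_pay := critical_bid f th (invited_sub (th i)) in
    let lose_pay := 0 in
    (f i th)%:R * win_pay + (1 - (f i th)%:R) * lose_pay.

(* Main.v *)
Require Import Defs.
From mathcomp Require Import all_boot all_order all_algebra.
From mathcomp Require Import boolp classical_sets reals.
Import Order.TTheory GRing.Theory Num.Theory.
Local Open Scope ring_scope.

(** Fix the others' reports and let bidder [i] report all her neighbors.  In an
    individually rational and strategyproof mechanism, a winning [i] pays at
    most what any other winning bid [x] would cost her, and that is at most [x];
    so she pays at most the infimum of the winning bids.  A loser pays at most 0.
    Charging exactly these bounds is strategyproof because, by IP-monotonicity,
    the critical bid decreases when more neighbors are invited. *)

Section CriticalBid.
Set Implicit Arguments.
Unset Strict Implicit.
Variables (R : realType) (N : finType) (e : rel (option N)).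
Implicit Types (i : N) (th : profile R e) (f : allocation R e).

Lemma dfwith_overwrite i th (t t' : report R e i) :
  dfwith (dfwith th t) t' = dfwith th t'.
Proof.
apply: functional_extensionality_dep => j.
have [<-|nij] := eqVneq i j; first by rewrite !dfwith_in.
by rewrite !dfwith_out.
Qed.

Lemma dfwith_id th i : dfwith th (th i) = th.
Proof.
apply: functional_extensionality_dep => j.
by have [<-|nij] := eqVneq i j; rewrite ?dfwith_in ?dfwith_out.
Qed.

(** The set of winning bids of [i] is built from the others' reports alone, so the entry [t] at [i]
    is overwritten. *)
Lemma critical_pay_dfwith f i th (t : report R e i) :
  critical_pay f i (dfwith th t) =
  (f i (dfwith th t))%:R * critical_bid f th (invited_sub t).
Proof.
rewrite /critical_pay mulr0 addr0 dfwith_in; congr (_ * inf _).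
by apply/seteqP; split=> x [hx fx]; exists hx; move: fx; rewrite dfwith_overwrite.
Qed.

Lemma critical_bid_le f i th (x : R) (hx : 0 <= x) (s : {set option N})
    (hs : s \subset neighbors e i) :
  f i (dfwith th (Report hx hs)) -> critical_bid f th hs <= x.
Proof. by move=> fx; apply: ge_inf; [exists 0 => y []|exists hx]. Qed.

(** The winning report [t] makes the set of winning bids nonempty, so its [inf] is a genuine infimum
    and not the default 0. *)
Lemma le_critical_bid f i th (t : report R e i) (y : R) :
  f i (dfwith th t) ->
  (forall (x : R) (hx : 0 <= x),
     f i (dfwith th (Report hx (invited_sub t))) -> y <= x) ->
  y <= critical_bid f th (invited_sub t).
Proof.
move=> ft yx; apply: lb_le_inf; last by move=> x [hx /yx].
by exists (bid t), (bid_ge0 t); case: t ft {yx}.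
Qed.

Lemma critical_pay_ir f : individually_rational (Mechanism f (critical_pay f)).
Proof.
move=> i v hv s hs th; rewrite /utility /= critical_pay_dfwith -mulrBr.
case: (boolP (f i _)) => [fi|_]; last by rewrite mul0r.
by rewrite mul1r subr_ge0; apply: critical_bid_le fi.
Qed.

Lemma critical_pay_sp f :
  ip_monotone f -> strategyproof (Mechanism f (critical_pay f)).
Proof.
move=> hf i v hv t th.
have [ft|nft] := boolP (f i (dfwith th t)); last first.
  (* A losing deviation yields utility 0, which truth-telling guarantees by individual
     rationality. *)
  rewrite {1}/utility /= critical_pay_dfwith (negbTE nft) !mul0r subr0.
  exact: critical_pay_ir.
rewrite /utility /= !critical_pay_dfwith ft !mul1r -mulrBr.
have [fv|nfv] := boolP (f i (dfwith th (true_type e i hv))).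
  (* Both reports win: each bid winning with [invited t] also wins with all neighbors, so
     truth-telling pays no more. *)
  rewrite mul1r lerB //; apply: le_critical_bid => // x hx fx.
  apply: (critical_bid_le (hx := hx)); apply: hf fx _.
  by split=> //; apply: invited_sub.
(* Only [t] wins: a winning bid below [v] would make the truthful report win too, so the deviation
   costs at least [v]. *)
rewrite mul0r subr_le0; apply: le_critical_bid => // x hx fx.
rewrite leNgt; apply: contra nfv => xv; apply: hf fx _.
by split; [apply: ltW|apply: invited_sub].
Qed.

Lemma pay_le_critical_pay f (p : payment R e) i (v : R) (hv : 0 <= v) th :
  individually_rational (Mechanism f p) -> strategyproof (Mechanism f p) ->
  p i (dfwith th (true_type e i hv)) <=
  critical_pay f i (dfwith th (true_type e i hv)).
Proof.
move=> ir sp; rewrite critical_pay_dfwith.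
have [fv|nfv] := boolP (f i (dfwith th (true_type e i hv))).
  rewrite mul1r; apply: le_critical_bid => // x hx fx.
  (* Both reports win, so the value terms cancel and only payments are compared. *)
  have := sp i v hv (true_type e i hx) th.
  have := ir i x hx _ (subxx (neighbors e i)) th.
  rewrite /utility /= fv fx !mul1r subr_ge0 lerD2l lerN2 => px pv.
  exact: le_trans pv px.
have := ir i v hv _ (subxx (neighbors e i)) th.
by rewrite /utility /= (negbTE nfv) !mul0r sub0r oppr_ge0.
Qed.

End CriticalBid.

Theorem theorem4p4 (R : realType) (N : finType) (e : rel (option N))
    (v : N -> R) (hv : forall i, 0 <= v i)
    (f : allocation R e) (hf : ip_monotone f) :
  let theta : profile R e := fun i => true_type e i (hv i) in
  let Mstar := Mechanism f (critical_pay f) in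
  individually_rational Mstar /\
  strategyproof Mstar /\
  (forall p' : payment R e,
     individually_rational (Mechanism f p') ->
     strategyproof (Mechanism f p') ->
     revenue (Mechanism f p') theta <= revenue Mstar theta).
Proof.
move=> theta Mstar; split; first exact: critical_pay_ir.
split; first exact: critical_pay_sp.
move=> p' ir sp; apply: ler_sum => i _ /=.
by rewrite -(dfwith_id theta i); apply: pay_le_critical_pay.
Qed.
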